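(* For every integer $n\ge1$ and every $f\in\mathcal{E}_n^-$, $$\int_0^\infty |f(t)|^2e^{-t}\,dt \le \left(1+8190\,e^{-n/10}\right)\int_0^{9n}|f(t)|^2e^{-t}\,dt.$$ In particular this holds for every $f\in\mathcal{T}_n$.
   Context: $\mathcal{E}_n^-$ denotes the set of all functions $f(t)=\sum_{j=1}^n a_j e^{\lambda_j t}$ ($t\in\mathbb{R}$) with $a_j,\lambda_j\in\mathbb{C}$ and $\mathrm{Re}(\lambda_j)\le 0$ for all $j$. $\mathcal{T}_n$ denotes the set of all functions $f(t)=\sum_{j=1}^n a_j e^{i\lambda_j t}$ with $a_j\in\mathbb{C}$ (possibly zero) and real $\lambda_1<\cdots<\lambda_n$. *)

(* Defs.v *)
From Stdlib Require Import Reals Lra.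
Open Scope R_scope.

Fixpoint sumR (n : nat) (F : nat -> R) : R :=
  match n with
  | O => 0
  | S m => sumR m F + F m
  end.

(* f(t) = sum_{j<n} a_j e^{lambda_j t}, with a_j = ar j + i ai j and
   lambda_j = lr j + i li j.  Real and imaginary parts of f(t): *)
Definition expsum_re (n : nat) (ar ai lr li : nat -> R) (t : R) : R :=
  sumR n (fun j => exp (lr j * t) * (ar j * cos (li j * t) - ai j * sin (li j * t))).

Definition expsum_im (n : nat) (ar ai lr li : nat -> R) (t : R) : R :=
  sumR n (fun j => exp (lr j * t) * (ar j * sin (li j * t) + ai j * cos (li j * t))).

Definition expsum_abs2 (n : nat) (ar ai lr li : nat -> R) (t : R) : R :=
  expsum_re n ar ai lr li t ^ 2 + expsum_im n ar ai lr li t ^ 2.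

Definition is_RInt (g : R -> R) (a b v : R) : Prop :=
  exists pr : Riemann_integrable g a b, RiemannInt pr = v.

Definition is_improper_int0 (g : R -> R) (L : R) : Prop :=
  (forall T, 0 <= T -> exists v, is_RInt g 0 T v) /\
  (forall eps, 0 < eps -> exists M, forall T v, M <= T -> is_RInt g 0 T v ->
     Rabs (v - L) < eps).

(* Main.v *)
(** Put [u m = f (t + d m)]. If [w] is one of the [n] numbers
    [exp (lambda_j d)], all of modulus at most 1, then [m |-> u (m+1) - w u m]
    is again an exponential sum, with one exponent fewer, and it is at most [2 A]
    at its first [n-1] places when [|u| <= A] at its first [n] places. By
    induction on [n] this gives Turan's bound [|u M| <= A (1+2x)^M / x^n] for any
    [0 < x <= 1]. Squaring and integrating over [0 <= t <= d] bounds the integral of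
    [|f t|^2 exp (-t)] over [[d M, d (M+1)]] by
    [((1+2x)^2 exp (-d))^M (exp d / x^2)^n] times the integral over [[0, d n]],
    and these bounds are summed over [M >= 3 n], with [d = 3] and [x = 1/4]. *)

From Stdlib Require Import Reals Lra Lia.
From Coquelicot Require Import Coquelicot.
Require Import Defs.
Open Scope R_scope.

(** * Turan's bound for sums of complex geometric sequences *)

Fixpoint sumC (n : nat) (F : nat -> C) : C :=
  match n with
  | O => 0%C
  | S m => (sumC m F + F m)%C
  end.

Lemma sumC_shift_sub (n : nat) (w : nat -> C) (z : nat -> nat -> C) (v : C) (m : nat) :
  (forall j, (j < n)%nat -> z j (S m) = (w j * z j m)%C) ->
  (sumC n (fun j => z j (S m)) - v * sumC n (fun j => z j m))%C
  = sumC n (fun j => ((w j - v) * z j m)%C).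
Proof.
  induction n as [|n IH]; intros Hz; simpl.
  - ring.
  - rewrite <- IH by (intros j Hj; apply Hz; lia).
    rewrite (Hz n) by lia. ring.
Qed.

(** The terms are described only by the recurrence [z j (S m) = w j * z j m], so the factor
    [w j - w n] produced by the reduction is absorbed into the new terms while the ratios stay the
    same. Nothing is divided by that factor, so coinciding ratios do no harm. The parameter [x]
    trades growth in [M] against growth in [n]. *)
Lemma exponential_sequence_bound (x : R) (n : nat) :
  0 < x <= 1 ->
  forall (w : nat -> C) (z : nat -> nat -> C) (A : R),
  (forall j, (j < n)%nat -> Cmod (w j) <= 1) ->
  (forall j m, (j < n)%nat -> z j (S m) = (w j * z j m)%C) ->
  0 <= A ->
  (forall k, (k < n)%nat -> Cmod (sumC n (fun j => z j k)) <= A) ->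
  forall M, Cmod (sumC n (fun j => z j M)) <= A * (1 + 2 * x) ^ M * (/ x) ^ n.
Proof.
  intros Hx.
  assert (Hix : 1 <= / x) by (rewrite <- Rinv_1; apply Rinv_le_contravar; lra).
  induction n as [|n IH]; intros w z A Hw Hz HA Hk M.
  - simpl. rewrite Cmod_0.
    assert (0 <= (1 + 2 * x) ^ M) by (apply pow_le; lra). nra.
  - set (u := fun m => sumC (S n) (fun j => z j m)).
    set (z' := fun j m => ((w j - w n) * z j m)%C).
    assert (Hu : forall m, u (S m) = (w n * u m + sumC n (fun j => z' j m))%C).
    { intros m. unfold z'.
      rewrite <- sumC_shift_sub by (intros j Hj; apply Hz; lia).
      unfold u; simpl. rewrite (Hz n m) by lia. ring. }
    assert (Hwn : Cmod (w n) <= 1) by (apply Hw; lia).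
    assert (Hwu : forall m, Cmod (w n * u m) <= Cmod (u m)).
    { intros m. rewrite Cmod_mult. pose proof (Cmod_ge_0 (u m)). nra. }
    assert (Hv : forall m, Cmod (sumC n (fun j => z' j m))
                           <= 2 * A * (1 + 2 * x) ^ m * (/ x) ^ n).
    { apply (IH w z').
      - intros j Hj; apply Hw; lia.
      - intros j m Hj. unfold z'. rewrite (Hz j m) by lia. ring.
      - lra.
      (* For [k < n], both [k] and [S k] lie among the first [S n] places, where [u] is bounded by
         [A]. *)
      - intros k Hkn.
        replace (sumC n (fun j => z' j k)) with (u (S k) + - (w n * u k))%C
          by (rewrite Hu; ring).
        eapply Rle_trans; [apply Cmod_triangle|]. rewrite Cmod_opp.
        pose proof (Hwu k).
        assert (Cmod (u k) <= A) by (apply Hk; lia).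
        assert (Cmod (u (S k)) <= A) by (apply Hk; lia).
        lra. }
    change (Cmod (u M) <= A * (1 + 2 * x) ^ M * (/ x) ^ (S n)).
    induction M as [|M IHM].
    + assert (Cmod (u O) <= A) by (apply Hk; lia).
      assert (1 <= (/ x) ^ (S n)) by (apply pow_R1_Rle; exact Hix).
      rewrite pow_O. nra.
    + rewrite Hu. eapply Rle_trans; [apply Cmod_triangle|].
      specialize (Hwu M). specialize (Hv M).
      (* The claimed bound solves the recursion exactly: writing [2 = 2 * x * / x], the two
         contributions add up to the factor [1 + 2 * x]. *)
      replace (A * (1 + 2 * x) ^ S M * (/ x) ^ S n)
        with (A * (1 + 2 * x) ^ M * (/ x) ^ S n + 2 * A * (1 + 2 * x) ^ M * (/ x) ^ n)
        by (simpl; field; lra).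
      lra.
Qed.

(** * Finite real sums, and squared moduli at equally spaced points *)

Lemma sumR_le (n : nat) (F G : nat -> R) :
  (forall k, (k < n)%nat -> F k <= G k) -> sumR n F <= sumR n G.
Proof.
  induction n as [|n IH]; intros H; simpl.
  - lra.
  - apply Rplus_le_compat; [apply IH; intros; apply H|apply H]; lia.
Qed.

Lemma sumR_scal_l (n : nat) (c : R) (F : nat -> R) :
  sumR n (fun k => c * F k) = c * sumR n F.
Proof. induction n as [|n IH]; simpl; [|rewrite IH]; ring. Qed.

Lemma sumR_nonneg (n : nat) (F : nat -> R) :
  (forall k, 0 <= F k) -> 0 <= sumR n F.
Proof.
  intros H. induction n as [|n IH]; simpl; [lra|]. specialize (H n). lra.
Qed.

Lemma sumR_term_le (n : nat) (F : nat -> R) (k : nat) :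
  (forall j, 0 <= F j) -> (k < n)%nat -> F k <= sumR n F.
Proof.
  intros H Hk. induction n as [|n IH]; [lia|]. simpl.
  destruct (Nat.eq_dec k n) as [->|Hne].
  - pose proof (sumR_nonneg n F H). lra.
  - specialize (H n). assert (F k <= sumR n F) by (apply IH; lia). lra.
Qed.

Lemma exp_INR_mult (n : nat) (y : R) : exp (INR n * y) = exp y ^ n.
Proof.
  induction n as [|n IH].
  - rewrite Rmult_0_l. apply exp_0.
  - rewrite S_INR, Rmult_plus_distr_r, exp_plus, IH, Rmult_1_l. simpl. ring.
Qed.

Lemma expsum_abs2_nonneg (n : nat) (ar ai lr li : nat -> R) (t : R) :
  0 <= expsum_abs2 n ar ai lr li t.
Proof. unfold expsum_abs2. nra. Qed.

(** Turan's bound is applied with [A] the square root of the sum of squares at the [n] nodes. This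
    dominates each sampled modulus and, unlike the maximum, can be integrated in [t] term by
    term. *)
Lemma expsum_abs2_shift_bound (n : nat) (ar ai lr li : nat -> R) (x d t : R) (M : nat) :
  (forall j, (j < n)%nat -> lr j <= 0) ->
  0 < x <= 1 -> 0 <= d ->
  expsum_abs2 n ar ai lr li (t + d * INR M)
  <= ((1 + 2 * x) ^ 2) ^ M * ((/ x) ^ 2) ^ n
     * sumR n (fun k => expsum_abs2 n ar ai lr li (t + d * INR k)).
Proof.
  intros Hl Hx Hd.
  set (S2 := sumR n _).
  set (term := fun j s =>
    (exp (lr j * s) * (ar j * cos (li j * s) - ai j * sin (li j * s)),
     exp (lr j * s) * (ar j * sin (li j * s) + ai j * cos (li j * s))) : C).
  set (w := fun j => (exp (lr j * d) * cos (li j * d),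
                      exp (lr j * d) * sin (li j * d)) : C).
  set (z := fun j m => term j (t + d * INR m)).
  assert (Hsum : forall s, Cmod (sumC n (fun j => term j s))
                           = sqrt (expsum_abs2 n ar ai lr li s)).
  { intros s. unfold Cmod, expsum_abs2. f_equal.
    replace (sumC n (fun j => term j s))
      with ((expsum_re n ar ai lr li s, expsum_im n ar ai lr li s) : C).
    - reflexivity.
    - unfold expsum_re, expsum_im.
      induction n as [|p IH]; simpl; [reflexivity|].
      rewrite <- IH; [reflexivity|]. intros j Hj; apply Hl; lia. }
  assert (HS2 : 0 <= S2)
    by (apply sumR_nonneg; intros; apply expsum_abs2_nonneg).
  assert (HM : Cmod (sumC n (fun j => z j M))
               <= sqrt S2 * (1 + 2 * x) ^ M * (/ x) ^ n).
  { apply (exponential_sequence_bound x n Hx w z).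
    - intros j Hj. unfold w, Cmod; simpl fst; simpl snd.
      replace ((exp (lr j * d) * cos (li j * d)) ^ 2
               + (exp (lr j * d) * sin (li j * d)) ^ 2)
        with (Rsqr (exp (lr j * d)))
        by (pose proof (sin2_cos2 (li j * d)) as Hsc; unfold Rsqr in *;
            transitivity (exp (lr j * d) * exp (lr j * d)
                * (sin (li j * d) * sin (li j * d) + cos (li j * d) * cos (li j * d)));
            [rewrite Hsc|]; ring).
      rewrite sqrt_Rsqr by (left; apply exp_pos).
      rewrite <- exp_0. specialize (Hl j Hj).
      destruct (Rle_lt_or_eq_dec (lr j * d) 0) as [H|H]; [nra| |].
      + left; now apply exp_increasing.
      + rewrite H; lra.
    - intros j m _. unfold z, w, term. rewrite S_INR.
      replace (lr j * (t + d * (INR m + 1)))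
        with (lr j * d + lr j * (t + d * INR m)) by ring.
      replace (li j * (t + d * (INR m + 1)))
        with (li j * d + li j * (t + d * INR m)) by ring.
      rewrite exp_plus, cos_plus, sin_plus.
      unfold Cmult; simpl. f_equal; ring.
    - apply sqrt_pos.
    - intros k Hk. unfold z. rewrite Hsum. apply sqrt_le_1_alt.
      unfold S2.
      apply (sumR_term_le n (fun k => expsum_abs2 n ar ai lr li (t + d * INR k)));
        [intros; apply expsum_abs2_nonneg|exact Hk]. }
  unfold z in HM. rewrite Hsum in HM.
  rewrite <- (sqrt_sqrt (expsum_abs2 n ar ai lr li (t + d * INR M)))
    by apply expsum_abs2_nonneg.
  rewrite <- (sqrt_sqrt S2) by exact HS2.
  (* Exchanging the exponents exhibits the right-hand side as the square of the bound in [HM]. *)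
  rewrite <- !pow_mult, !(Nat.mul_comm 2), !pow_mult.
  pose proof (sqrt_pos (expsum_abs2 n ar ai lr li (t + d * INR M))).
  eapply Rle_trans; [apply Rmult_le_compat; [assumption|assumption|exact HM|exact HM]|].
  apply Req_le. ring.
Qed.

(** * Tail integrals of a continuous function *)

Section tail_integral.

Variable g : R -> R.
Hypothesis g_continuous : forall t, continuous g t.

Lemma ex_RInt_shift (v a b : R) : ex_RInt (fun t => g (t + v)) a b.
Proof.
  apply (ex_RInt_continuous (V := R_CompleteNormedModule)). intros s _.
  apply (continuous_comp (fun t => t + v) g); [|apply g_continuous].
  apply (continuous_plus (V := R_NormedModule));
    [apply continuous_id|apply continuous_const].
Qed.

Lemma ex_RInt_everywhere (a b : R) : ex_RInt g a b.
Proof.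
  apply (ex_RInt_continuous (V := R_CompleteNormedModule)). intros s _.
  apply g_continuous.
Qed.

Lemma RInt_Chasles_everywhere (a b c : R) : RInt g a b + RInt g b c = RInt g a c.
Proof.
  exact (RInt_Chasles (V := R_CompleteNormedModule) g a b c
           (ex_RInt_everywhere a b) (ex_RInt_everywhere b c)).
Qed.

Lemma RInt_shift (v a b : R) : RInt (fun t => g (t + v)) a b = RInt g (a + v) (b + v).
Proof.
  rewrite <- (Rmult_1_l a) at 2. rewrite <- (Rmult_1_l b) at 2.
  rewrite <- (RInt_comp_lin (V := R_CompleteNormedModule)) by apply ex_RInt_everywhere.
  apply RInt_ext. intros s _. unfold scal; simpl; unfold mult; simpl.
  now rewrite !Rmult_1_l.
Qed.

(** Translation carries [[0, d]] to consecutive blocks that tile [[0, d * n]]. The qualified name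
    [RInt.is_RInt] is Coquelicot's predicate; unqualified, [is_RInt] is the one built on
    [RiemannInt]. *)
Lemma is_RInt_sum_of_shifts (d : R) (n : nat) :
  RInt.is_RInt (fun t => sumR n (fun k => g (t + d * INR k))) 0 d (RInt g 0 (d * INR n)).
Proof.
  induction n as [|n IH].
  - simpl. rewrite Rmult_0_r.
    rewrite (RInt_point (V := R_CompleteNormedModule)).
    pose proof (is_RInt_const (V := R_NormedModule) 0 d 0) as H.
    unfold scal in H; simpl in H; unfold mult in H; simpl in H.
    rewrite Rmult_0_r in H. exact H.
  - rewrite <- (RInt_Chasles_everywhere 0 (d * INR n)).
    simpl sumR.
    apply (is_RInt_plus (V := R_NormedModule)); [exact IH|].
    replace (RInt g (d * INR n) (d * INR (S n)))
      with (RInt (fun t => g (t + d * INR n)) 0 d).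
    + apply (RInt_correct (V := R_CompleteNormedModule)). apply ex_RInt_shift.
    + rewrite RInt_shift, S_INR. f_equal; ring.
Qed.

(** Integrating the hypothesis over [[0, d]] bounds each block by a multiple of [q ^ M]. The factor
    [1 - q] makes the finite geometric sum telescope, so no division or infinite series occurs. *)
Lemma geometric_tail_integral (d c q : R) (n : nat) :
  0 <= d ->
  (forall t M, g (t + d * INR M)
               <= c * q ^ M * sumR n (fun k => g (t + d * INR k))) ->
  q <= 1 ->
  forall M N,
  (1 - q) * RInt g (d * INR M) (d * INR (M + N))
  <= c * (q ^ M - q ^ (M + N)) * RInt g 0 (d * INR n).
Proof.
  intros Hd Hg Hq M N.
  induction N as [|N IH].
  - rewrite Nat.add_0_r, (RInt_point (V := R_CompleteNormedModule)).
    unfold zero; simpl. lra.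
  - rewrite <- (RInt_Chasles_everywhere _ (d * INR (M + N))).
    assert (Hblock : RInt g (d * INR (M + N)) (d * INR (M + S N))
                     <= c * q ^ (M + N) * RInt g 0 (d * INR n)).
    { replace (RInt g (d * INR (M + N)) (d * INR (M + S N)))
        with (RInt (fun t => g (t + d * INR (M + N))) 0 d)
        by (rewrite RInt_shift, Nat.add_succ_r, S_INR; f_equal; ring).
      pose proof (is_RInt_scal (V := R_NormedModule) _ 0 d (c * q ^ (M + N)) _
                    (is_RInt_sum_of_shifts d n)) as Hs.
      eapply Rle_trans;
        [|apply Req_le; exact (is_RInt_unique (V := R_CompleteNormedModule) _ _ _ _ Hs)].
      apply RInt_le.
      - exact Hd.
      - apply ex_RInt_shift.
      - eexists; exact Hs.
      - intros t _. apply Hg. }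
    rewrite Nat.add_succ_r in *. simpl pow.
    apply (Rmult_le_compat_l (1 - q)) in Hblock; lra.
Qed.

Lemma is_RInt_of_RInt (a b : R) : is_RInt g a b (RInt g a b).
Proof.
  exists (ex_RInt_Reals_0 _ _ _ (ex_RInt_everywhere a b)).
  now rewrite <- RInt_Reals.
Qed.

Lemma is_RInt_eq_RInt (a b v : R) : is_RInt g a b v -> v = RInt g a b.
Proof. intros [pr <-]. symmetry. apply RInt_Reals. Qed.

(** As [g] is nonnegative, its integral over [[0, T]] increases with [T], so the supremum of these
    integrals is their limit. *)
Lemma improper_integral_of_bounded (B : R) :
  (forall t, 0 <= g t) ->
  (forall T, 0 <= T -> RInt g 0 T <= B) ->
  exists L, is_improper_int0 g L /\ L <= B.
Proof.
  intros Hg HB.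
  destruct (completeness (fun y => exists T, 0 <= T /\ y = RInt g 0 T))
    as [L [Hub Hlub]].
  - exists B. intros y [T [HT ->]]. now apply HB.
  - exists (RInt g 0 0), 0. split; [lra|reflexivity].
  - exists L. split; [split|].
    + intros T _. exists (RInt g 0 T). apply is_RInt_of_RInt.
    + intros eps Heps.
      assert (exists T0, 0 <= T0 /\ L - eps < RInt g 0 T0) as [T0 [HT0 Hlt]].
      { apply Classical_Prop.NNPP. intros Hno.
        assert (L <= L - eps); [|lra].
        apply Hlub. intros y [T [HT ->]].
        apply Rnot_lt_le. intros Hc. apply Hno. now exists T. }
      exists T0. intros T v HT Hv.
      rewrite (is_RInt_eq_RInt _ _ _ Hv).
      assert (RInt g 0 T <= L) by (apply Hub; exists T; split; [lra|reflexivity]).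
      assert (0 <= RInt g T0 T)
        by (apply RInt_ge_0; [lra|apply ex_RInt_everywhere|intros; apply Hg]).
      pose proof (RInt_Chasles_everywhere 0 T0 T).
      apply Rabs_def1; lra.
    + apply Hlub. intros y [T [HT ->]]. now apply HB.
Qed.

End tail_integral.

(** * Continuity, numerical constants and the final estimate *)

Lemma continuous_sumR (n : nat) (F : nat -> R -> R) (t : R) :
  (forall j, continuous (F j) t) -> continuous (fun s => sumR n (fun j => F j s)) t.
Proof.
  intros H. induction n as [|n IH]; simpl.
  - apply continuous_const.
  - exact (continuous_plus (V := R_NormedModule) _ _ _ IH (H n)).
Qed.

Lemma continuous_expsum_weighted (n : nat) (ar ai lr li : nat -> R) (t : R) :
  continuous (fun s => expsum_abs2 n ar ai lr li s * exp (- s)) t.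
Proof.
  assert (Hsq : forall f : R -> R, continuous f t -> continuous (fun s => f s ^ 2) t).
  { intros f Hf. simpl.
    apply (continuous_mult (K := R_AbsRing)); [exact Hf|].
    apply (continuous_mult (K := R_AbsRing)); [exact Hf|apply continuous_const]. }
  apply (continuous_mult (K := R_AbsRing)).
  - apply (continuous_plus (V := R_NormedModule)); apply Hsq; apply continuous_sumR;
      intros j; apply (ex_derive_continuous (V := R_NormedModule)); auto_derive; exact I.
  - apply (ex_derive_continuous (V := R_NormedModule)); auto_derive; exact I.
Qed.

(** Serves to keep the geometric ratio [9 / 4 * exp (- 3)] below 1/2. *)
Lemma exp_3_ge_8 : 8 <= exp 3.
Proof.
  replace 3 with (INR 3 * 1) by (simpl; ring).
  rewrite exp_INR_mult. pose proof (exp_ineq1 1 ltac:(lra)).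
  replace 8 with (2 ^ 3) by ring.
  apply pow_incr; lra.
Qed.

(* The left-hand side is [((1+2x)^2 exp (-d))^3 exp d / x^2] for [d = 3], [x = 1/4]. *)
Lemma decay_rate_le : (9 / 4 * exp (- 3)) ^ 3 * (16 * exp 3) <= exp (- (1 / 10)).
Proof.
  replace ((9 / 4 * exp (- 3)) ^ 3 * (16 * exp 3)) with (729 / 4 * exp (- 6)).
  2:{ replace (exp (- 6)) with (exp (- 3) ^ 3 * exp 3).
      - field.
      - rewrite <- exp_INR_mult, <- exp_plus. f_equal. simpl; ring. }
  (* Since -1/10 = 59/10 - 6, the claim becomes 729/4 <= exp (59/10), which follows from exp (1/10)
     > 11/10 raised to the power 59. *)
  replace (exp (- (1 / 10))) with (exp (INR 59 * (1 / 10)) * exp (- 6))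
    by (rewrite <- exp_plus; f_equal; simpl; field).
  apply Rmult_le_compat_r; [left; apply exp_pos|].
  rewrite exp_INR_mult.
  apply Rle_trans with ((1 + 1 / 10) ^ 59); [lra|].
  apply pow_incr. split; [lra|]. left. apply exp_ineq1. lra.
Qed.

Theorem theorem3p1 (n : nat) (ar ai lr li : nat -> R) :
  (1 <= n)%nat ->
  (forall j, (j < n)%nat -> lr j <= 0) ->
  exists L I9,
    is_improper_int0 (fun t => expsum_abs2 n ar ai lr li t * exp (- t)) L /\
    is_RInt (fun t => expsum_abs2 n ar ai lr li t * exp (- t)) 0 (9 * INR n) I9 /\
    L <= (1 + 8190 * exp (- INR n / 10)) * I9.
Proof.
  intros Hn Hl.
  set (g := fun t => expsum_abs2 n ar ai lr li t * exp (- t)).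
  assert (Hc : forall t, continuous g t) by apply continuous_expsum_weighted.
  assert (Hg0 : forall t, 0 <= g t).
  { intros t. apply Rmult_le_pos; [apply expsum_abs2_nonneg|left; apply exp_pos]. }
  assert (Hpos : forall a b, a <= b -> 0 <= RInt g a b).
  { intros a b Hab. apply RInt_ge_0;
      [exact Hab|now apply ex_RInt_everywhere|intros; apply Hg0]. }
  pose proof (RInt_Chasles_everywhere g Hc) as Hch.
  pose proof (pos_INR n) as HINR.
  (* With [d = 3] and [x = 1/4], [q] is [(1+2x)^2 exp (-d)] and [c] is [(exp d / x^2)^n]. *)
  set (q := 9 / 4 * exp (- 3)).
  set (c := (16 * exp 3) ^ n).
  assert (Hq : 0 <= q <= 1 / 2).
  { pose proof exp_3_ge_8 as H8. pose proof (exp_pos (- 3)).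
    assert (exp 3 * exp (- 3) = 1) by (rewrite <- exp_plus, <- exp_0; f_equal; ring).
    unfold q. split; nra. }
  assert (Hc0 : 0 <= c) by (apply pow_le; pose proof (exp_pos 3); lra).
  assert (Hshift : forall t M, g (t + 3 * INR M)
                     <= c * q ^ M * sumR n (fun k => g (t + 3 * INR k))).
  { intros t M.
    pose proof (expsum_abs2_shift_bound n ar ai lr li (1 / 4) 3 t M Hl
                  ltac:(lra) ltac:(lra)) as H.
    apply (Rmult_le_compat_r (exp (- (t + 3 * INR M)))) in H; [|left; apply exp_pos].
    eapply Rle_trans; [exact H|]. clear H.
    replace (exp (- (t + 3 * INR M))) with (exp (- t) * exp (- 3) ^ M)
      by (rewrite <- exp_INR_mult, <- exp_plus; f_equal; ring).
    unfold c, q. rewrite !Rpow_mult_distr.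
    replace ((1 + 2 * (1 / 4)) ^ 2) with (9 / 4) by field.
    replace ((/ (1 / 4)) ^ 2) with 16 by field.
    apply Rle_trans with ((9 / 4) ^ M * 16 ^ n * exp (- 3) ^ M
       * (exp (- t) * sumR n (fun k => expsum_abs2 n ar ai lr li (t + 3 * INR k)))).
    { apply Req_le; ring. }
    apply Rle_trans with ((9 / 4) ^ M * 16 ^ n * exp (- 3) ^ M
       * (exp 3 ^ n * sumR n (fun k => g (t + 3 * INR k)))).
    2:{ apply Req_le; ring. }
    apply Rmult_le_compat_l.
    { pose proof (exp_pos (- 3)). repeat apply Rmult_le_pos; apply pow_le; lra. }
    (* The weight at the nodes: for [k < n], [exp (-t)] is at most [exp (3 n) * exp (-(t + 3 k))],
       which accounts for the factor [exp 3 ^ n] in [c]. *)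
    rewrite <- !sumR_scal_l. apply sumR_le. intros k Hk.
    unfold g.
    apply Rle_trans with (expsum_abs2 n ar ai lr li (t + 3 * INR k)
       * (exp 3 ^ n * exp (- (t + 3 * INR k)))); [|apply Req_le; ring].
    rewrite (Rmult_comm (exp (- t))).
    apply Rmult_le_compat_l; [apply expsum_abs2_nonneg|].
    rewrite <- exp_INR_mult, <- exp_plus.
    apply lt_INR in Hk. left. apply exp_increasing. lra. }
  set (I9 := RInt g 0 (9 * INR n)).
  set (E := exp (- INR n / 10)).
  assert (HI3 : 0 <= RInt g 0 (3 * INR n) <= I9).
  { unfold I9. rewrite <- (Hch 0 (3 * INR n) (9 * INR n)).
    pose proof (Hpos 0 (3 * INR n) ltac:(lra)).
    pose proof (Hpos (3 * INR n) (9 * INR n) ltac:(lra)). lra. }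
  assert (HE : c * q ^ (3 * n) <= E).
  { unfold c, E. rewrite pow_mult, <- Rpow_mult_distr.
    replace (- INR n / 10) with (INR n * - (1 / 10)) by field.
    rewrite exp_INR_mult. apply pow_incr.
    pose proof decay_rate_le. fold q in H. split; [|lra].
    apply Rmult_le_pos; [pose proof (exp_pos 3); lra|apply pow_le; lra]. }
  (* The tail starts at block [3 * n], because 3 * (3 n) = 9 n. The factor 2 bounds [1 / (1 - q)],
     as [q <= 1/2]. *)
  assert (Htail : forall N, RInt g (9 * INR n) (3 * INR (3 * n + N)) <= 2 * E * I9).
  { intros N.
    pose proof (geometric_tail_integral g Hc 3 c q n ltac:(lra) Hshift
                  ltac:(lra) (3 * n) N) as H.
    replace (3 * INR (3 * n)) with (9 * INR n) in H
      by (rewrite mult_INR; simpl INR; ring).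
    assert (0 <= RInt g (9 * INR n) (3 * INR (3 * n + N))).
    { apply Hpos. rewrite plus_INR, mult_INR. pose proof (pos_INR N). simpl INR; lra. }
    assert (0 <= c * q ^ (3 * n + N))
      by (apply Rmult_le_pos; [|apply pow_le]; lra).
    assert (c * (q ^ (3 * n) - q ^ (3 * n + N)) * RInt g 0 (3 * INR n) <= E * I9).
    { apply Rle_trans with (E * RInt g 0 (3 * INR n)).
      - apply Rmult_le_compat_r; lra.
      - apply Rmult_le_compat_l; [left; apply exp_pos|lra]. }
    nra. }
  destruct (improper_integral_of_bounded g Hc (I9 + 2 * E * I9) Hg0) as [L [HL HLB]].
  { intros T HT.
    (* Any [T] lies before the end of some block, so nonnegativity reduces the bound to whole
       blocks. *)
    destruct (INR_unbounded T) as [N HN].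
    pose proof (pos_INR N).
    assert (T <= 3 * INR (3 * n + N)) by (rewrite plus_INR, mult_INR; simpl INR; lra).
    specialize (Htail N).
    pose proof (Hpos T (3 * INR (3 * n + N)) ltac:(lra)).
    pose proof (Hch 0 T (3 * INR (3 * n + N))).
    pose proof (Hch 0 (9 * INR n) (3 * INR (3 * n + N))).
    unfold I9 in *. lra. }
  exists L, I9. split; [exact HL|split].
  - now apply is_RInt_of_RInt.
  (* The constant obtained is 2; nonnegativity of [E * I9] allows it to be raised to 8190. *)
  - assert (0 <= E * I9) by (apply Rmult_le_pos; [left; apply exp_pos|lra]).
    fold E. lra.
Qed.
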